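(* Let $\sigma>0$, $\mu\ge0$ be constants. Define for each $\omega>0$ $$r:=\frac{\omega\sqrt{(\mu\sigma-1)^2\omega^2+(\mu+\sigma\omega^2)^2}}{1+\sigma^2\omega^2},\qquad a:=\sqrt r\cos(\theta/2),\qquad b:=\sqrt r\sin(\theta/2),$$ where $\theta\in(0,\pi)$ is the unique angle that satisfies $$\cos(\theta)=\frac{(\mu\sigma-1)\omega^2}{(1+\sigma^2\omega^2)r},\qquad \sin(\theta)=\frac{(\mu+\sigma\omega^2)\omega}{(1+\sigma^2\omega^2)r}.$$ Then $$\gamma_2\ge\sup_{\omega>0}\left(Q(\omega)\right),$$ where $Q(\omega):=\sqrt{p+\sqrt M}$ with $$M:=\frac{4(a^2+b^2)-4\left(b\sin(2b)\cosh(2a)+a\sinh(2a)\cos(2b)\right)+\sinh^2(2a)+\sin^2(2b)}{16(a^2+b^2)\left(\cosh(2a)-\cos(2b)\right)^2},$$ $$p=\frac{b\sinh(2a)-a\sin(2b)}{4ab\left(\cosh(2a)-\cos(2b)\right)}.$$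
   Context: For constants $\sigma>0$, $\mu\ge0$ consider the wave equation with Kelvin-Voigt and viscous damping $$\frac{\partial^2 u}{\partial t^2}(t,x)=\frac{\partial^2 u}{\partial x^2}(t,x)+\sigma\frac{\partial^3 u}{\partial t\,\partial x^2}(t,x)-\mu\frac{\partial u}{\partial t}(t,x),\quad (t,x)\in(0,+\infty)\times(0,1),$$ $$u(t,0)=d(t),\quad u(t,1)=0,\quad t\ge0,$$ with initial conditions $u[0]=f$, $\frac{\partial u}{\partial t}[0]=g$. Here $u[t]$ denotes the profile $x\mapsto u(t,x)$ (and similarly $\frac{\partial u}{\partial t}[t]$), the term $\frac{\partial^3u}{\partial t\,\partial x^2}$ is the second $x$-derivative of $\frac{\partial u}{\partial t}$, and $\mathbb{R}_+=[0,+\infty)$. $\|v\|_2=\left(\int_0^1|v(x)|^2dx\right)^{1/2}$. A solution means a function $u\in C^2(\mathbb{R}_+\times[0,1])$ with $\frac{\partial u}{\partial t}[t]\in C^2([0,1])$ for all $t\ge0$ satisfying the initial-boundary value problem consisting of the differential equation $\frac{\partial^2 u}{\partial t^2}(t,x)=\frac{\partial^2 u}{\partial x^2}(t,x)+\sigma\frac{\partial^3 u}{\partial t\,\partial x^2}(t,x)-\mu\frac{\partial u}{\partial t}(t,x)$ for $(t,x)\in(0,+\infty)\times(0,1)$, the boundary conditions $u(t,0)=d(t)$, $u(t,1)=0$ for $t\ge0$, and the initial conditions $u[0]=f$, $\frac{\partial u}{\partial t}[0]=g$. $X$ is the set of all $(f,g)\in C^2([0,1])\times C^2([0,1])$ for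 which there exists a bounded $d\in C^2(\mathbb{R}_+)$ such that the initial-boundary value problem has a unique solution. For $(f,g)\in X$, $\Phi(f,g)$ is the set of bounded $d\in C^2(\mathbb{R}_+)$ for which the initial-boundary value problem with data $f,g,d$ has a unique solution. The asymptotic gain of the displacement in the $L^2$ norm is $$\gamma_2:=\sup\left\{\frac{\limsup_{t\to+\infty}\|u[t]\|_2}{\sup_{t\ge0}|d(t)|}\;:\;(f,g)\in X,\ d\in\Phi(f,g),\ d\ne0\right\},$$ where $u$ is the solution corresponding to $f,g,d$. *)

(* Defs.v *)
From Stdlib Require Import Reals Lra.
From Coquelicot Require Import Coquelicot.
Open Scope R_scope.

(** ** Calculus relative to a closed domain

    A function on a subset is represented by a total function, of which only
    the values on the subset are ever used.  Derivatives are taken relative to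
    the subset [D], hence one-sided at an end point and ordinary at an interior
    point.  These notions are meant for [D] without isolated points. *)

Definition is_derive_on (D : R -> Prop) (f : R -> R) (x l : R) : Prop :=
  filterlim (fun y => (f y - f x) / (y - x)) (within D (locally' x)) (locally l).

Definition ex_derive_on (D : R -> Prop) (f : R -> R) (x : R) : Prop :=
  exists l : R, is_derive_on D f x l.

Definition Derive_on (D : R -> Prop) (f : R -> R) (x : R) : R :=
  iota (is_derive_on D f x).

Fixpoint Ck_on (k : nat) (D : R -> Prop) (f : R -> R) : Prop :=
  continuous_on D f /\
  match k with
  | O => True
  | S k' => (forall x, D x -> ex_derive_on D f x) /\ Ck_on k' D (Derive_on D f)
  end.

Definition half_line (t : R) : Prop := 0 <= t.
Definition unit_interval (x : R) : Prop := 0 <= x <= 1.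
Definition strip (p : R * R) : Prop := half_line (fst p) /\ unit_interval (snd p).

Definition Dt (u : R -> R -> R) (t x : R) : R :=
  Derive_on half_line (fun s => u s x) t.
Definition Dx (u : R -> R -> R) (t x : R) : R :=
  Derive_on unit_interval (u t) x.

(** Continuity below is joint continuity on the closed strip. *)
Fixpoint Ck_strip (k : nat) (u : R -> R -> R) : Prop :=
  continuous_on strip (fun p : R * R => u (fst p) (snd p)) /\
  match k with
  | O => True
  | S k' =>
      (forall t x, half_line t -> unit_interval x ->
         ex_derive_on half_line (fun s => u s x) t /\
         ex_derive_on unit_interval (u t) x) /\
      Ck_strip k' (Dt u) /\ Ck_strip k' (Dx u)
  end.

(** ** The initial-boundary value problem *)

Definition is_solution (sigma mu : R) (f g d : R -> R) (u : R -> R -> R) : Prop :=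
  Ck_strip 2 u /\
  (forall t, 0 <= t -> Ck_on 2 unit_interval (Dt u t)) /\
  (forall t x, 0 < t -> 0 < x < 1 ->
     Dt (Dt u) t x
     = Dx (Dx u) t x + sigma * Dx (Dx (Dt u)) t x - mu * Dt u t x) /\
  (forall t, 0 <= t -> u t 0 = d t /\ u t 1 = 0) /\
  (forall x, 0 <= x <= 1 -> u 0 x = f x /\ Dt u 0 x = g x).

Definition has_unique_solution (sigma mu : R) (f g d : R -> R) : Prop :=
  exists u, is_solution sigma mu f g d u /\
    forall v, is_solution sigma mu f g d v ->
      forall t x, 0 <= t -> 0 <= x <= 1 -> v t x = u t x.

Definition bounded_C2 (d : R -> R) : Prop :=
  Ck_on 2 half_line d /\ exists B, forall t, 0 <= t -> Rabs (d t) <= B.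

Definition Phi (sigma mu : R) (f g : R -> R) (d : R -> R) : Prop :=
  bounded_C2 d /\ has_unique_solution sigma mu f g d.

Definition X (sigma mu : R) (f g : R -> R) : Prop :=
  Ck_on 2 unit_interval f /\ Ck_on 2 unit_interval g /\
  exists d, bounded_C2 d /\ has_unique_solution sigma mu f g d.

(** ** The asymptotic gain *)

Definition L2norm (v : R -> R) : R :=
  sqrt (RInt (fun x => Rabs (v x) ^ 2) 0 1).

Definition sup_half_line (d : R -> R) : Rbar :=
  Lub_Rbar (fun y => exists t, 0 <= t /\ y = Rabs (d t)).

(** Superior limit at infinity of a function on the half line. *)
Definition LimSup_infty (h : R -> R) : Rbar :=
  Rbar_glb (fun s => exists T, 0 <= T /\
    s = Lub_Rbar (fun y => exists t, T <= t /\ y = h t)).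

Definition gamma2 (sigma mu : R) : Rbar :=
  Rbar_lub (fun q => exists f g d u,
    X sigma mu f g /\ Phi sigma mu f g d /\
    (exists t, 0 <= t /\ d t <> 0) /\
    is_solution sigma mu f g d u /\
    q = Rbar_div (LimSup_infty (fun t => L2norm (u t))) (sup_half_line d)).

(** ** The lower bound *)

Definition r_of (sigma mu omega : R) : R :=
  omega * sqrt ((mu * sigma - 1) ^ 2 * omega ^ 2 + (mu + sigma * omega ^ 2) ^ 2)
  / (1 + sigma ^ 2 * omega ^ 2).

Definition is_theta (sigma mu omega : R) (theta : R) : Prop :=
  0 < theta < PI /\
  cos theta = (mu * sigma - 1) * omega ^ 2 / ((1 + sigma ^ 2 * omega ^ 2) * (r_of sigma mu omega)) /\
  sin theta = (mu + sigma * omega ^ 2) * omega / ((1 + sigma ^ 2 * omega ^ 2) * (r_of sigma mu omega)).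

Definition theta_of (sigma mu omega : R) : R := iota (is_theta sigma mu omega).

Definition a_of (sigma mu omega : R) : R := sqrt (r_of sigma mu omega) * cos ((theta_of sigma mu omega) / 2).
Definition b_of (sigma mu omega : R) : R := sqrt (r_of sigma mu omega) * sin ((theta_of sigma mu omega) / 2).

Definition M_of (sigma mu omega : R) : R :=
  let a := a_of sigma mu omega in let b := b_of sigma mu omega in
  (4 * (a ^ 2 + b ^ 2)
   - 4 * (b * sin (2 * b) * cosh (2 * a) + a * sinh (2 * a) * cos (2 * b))
   + sinh (2 * a) ^ 2 + sin (2 * b) ^ 2)
  / (16 * (a ^ 2 + b ^ 2) * (cosh (2 * a) - cos (2 * b)) ^ 2).

Definition p_of (sigma mu omega : R) : R :=
  let a := a_of sigma mu omega in let b := b_of sigma mu omega in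
  (b * sinh (2 * a) - a * sin (2 * b))
  / (4 * a * b * (cosh (2 * a) - cos (2 * b))).

Definition Q (sigma mu omega : R) : R := sqrt ((p_of sigma mu omega) + sqrt (M_of sigma mu omega)).

(** ** The definite descriptions above are meaningful *)

Lemma is_derive_on_unique (D : R -> Prop) (f : R -> R) (x l : R) :
  (forall eps : posreal, exists y, D y /\ y <> x /\ Rabs (y - x) < eps) ->
  is_derive_on D f x l -> Derive_on D f x = l.
Proof.
intros HD Hl. unfold Derive_on, is_derive_on.
apply (@iota_filterlim_locally R_AbsRing R_CompleteNormedModule); [|exact Hl].
split.
- intros [e He]. destruct (HD e) as [y [Dy [yx Hy]]].
  exact (He y Hy yx Dy).
- apply within_filter. apply within_filter. apply locally_filter.
Qed.

Lemma theta_of_correct (sigma mu omega : R) :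
  0 < sigma -> 0 <= mu -> 0 < omega -> is_theta sigma mu omega (theta_of sigma mu omega).
Proof.
intros Hs Hm Ho. unfold theta_of.
apply (@iota_correct R_AbsRing R_CompleteNormedModule).
set (A := (mu * sigma - 1) * omega). set (B := mu + sigma * omega ^ 2).
set (N := sqrt (A ^ 2 + B ^ 2)).
assert (HB : 0 < B) by (unfold B; apply Rplus_le_lt_0_compat; [lra|]; apply Rmult_lt_0_compat; [lra|apply pow_lt; lra]).
assert (HAB : 0 < A ^ 2 + B ^ 2) by (assert (H := pow2_ge_0 A); assert (0 < B ^ 2) by (apply pow_lt; lra); lra).
assert (HN : 0 < N) by (apply sqrt_lt_R0; exact HAB).
assert (HN2 : N * N = A ^ 2 + B ^ 2) by (apply sqrt_sqrt; lra).
assert (Hd : 0 < 1 + sigma ^ 2 * omega ^ 2).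
{ assert (H := Rmult_le_pos _ _ (pow2_ge_0 sigma) (pow2_ge_0 omega)). lra. }
assert (Hr : r_of sigma mu omega = omega * N / (1 + sigma ^ 2 * omega ^ 2)).
{ unfold r_of, N, A, B. do 3 f_equal. ring. }
assert (Hc : (mu * sigma - 1) * omega ^ 2 /
  ((1 + sigma ^ 2 * omega ^ 2) * r_of sigma mu omega) = A / N).
{ rewrite Hr; unfold A; field; repeat split; lra. }
assert (Hsn : (mu + sigma * omega ^ 2) * omega /
  ((1 + sigma ^ 2 * omega ^ 2) * r_of sigma mu omega) = B / N).
{ rewrite Hr; fold B; field; repeat split; lra. }
assert (Hq : (A / N) * (A / N) + (B / N) * (B / N) = 1).
{ replace (A / N * (A / N) + B / N * (B / N)) with ((A ^ 2 + B ^ 2) / (N * N)) by (field; lra).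
  rewrite HN2; field; lra. }
assert (Hp : 0 < B / N) by (apply Rdiv_lt_0_compat; lra).
assert (Hb : -1 < A / N < 1) by (split; nra).
exists (acos (A / N)). unfold is_theta. rewrite Hc, Hsn. split.
- split; [apply acos_bound_lt; exact Hb|]. split.
  + apply cos_acos; lra.
  + rewrite sin_acos by lra.
    replace (1 - (A / N)²) with (Rsqr (B / N)) by (unfold Rsqr; lra).
    apply sqrt_Rsqr; lra.
- intros th [Hth [Hcth _]]. rewrite <- Hcth. apply acos_cos; lra.
Qed.

(* Main.v *)
(* Let k = a + ib, so that k^2 (1 + i sigma omega) = - omega^2 + i mu omega.  Then
   u(t,x) = Re (exp (i omega t) sinh (k (1 - x))) / |sinh k|
   solves the equation, vanishes at x = 1, and at x = 0 equals a phase shift of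
   cos (omega t), whose supremum is 1.  Writing Z(x) = sinh (k (1 - x)) / |sinh k|,
     ||u[t]||_2^2 = (int |Z|^2 + Re (exp (2 i omega t) int Z^2)) / 2,
   whose maximum over t is p + sqrt M, with sqrt M = |int Z^2| / 2; by periodicity
   it is attained at arbitrarily large times.  Uniqueness of solutions holds because
   int (u_t^2 + u_x^2) is nonincreasing for the difference of two solutions. *)
From Stdlib Require Import Reals Lra.
From Coquelicot Require Import Coquelicot.
(* Last, since the reals of Stdlib also define a [Dx]. *)
Require Import Defs.
Open Scope R_scope.

(** * Calculus relative to a closed domain *)

(** The obstacle to the energy argument is regularity up to the boundary. The derivative u_txx is
    only known to be continuous in x at each fixed time, derivatives are one-sided on the boundary,
    and the equation holds in the open strip only. So the energy is differentiated under the
    integral in the form 2 u_t u_tt + 2 u_x u_xt, all of whose factors are jointly continuous; the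
    equation and the integration by parts enter afterwards, at one frozen positive time. They
    produce u_tx where the energy has u_xt, which calls for Schwarz's theorem inside the strip.
    Uniqueness itself is required because membership in [X] and in [Phi] demands it.

    The shape of M comes from the integral of sinh^2(ky) over [0,1], which is (sinh(2k)/(2k) - 1)/2.
    Hence sqrt M = |sinh(2k) - 2k| / (8 |k| |sinh k|^2), and 2 |sinh k|^2 = cosh(2a) - cos(2b). *)

Definition accumulating (D : R -> Prop) : Prop :=
  forall x, D x -> forall eps : posreal, exists y, D y /\ y <> x /\ Rabs (y - x) < eps.

Lemma accumulating_half_line : accumulating half_line.
Proof.
intros x Hx [e He]. exists (x + e / 2). simpl.
unfold half_line in *. split; [lra|]. split; [lra|].
replace (x + e / 2 - x) with (e / 2) by ring. rewrite Rabs_pos_eq; lra.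
Qed.

Lemma accumulating_unit_interval : accumulating unit_interval.
Proof.
intros x Hx [e He]. simpl. unfold unit_interval in *.
assert (Hm : 0 < Rmin (e / 2) (1 / 2)) by (apply Rmin_glb_lt; lra).
assert (H1 := Rmin_l (e / 2) (1 / 2)). assert (H2 := Rmin_r (e / 2) (1 / 2)).
(* A step of length at most 1/2 towards the farther end point stays in the interval. *)
destruct (Rle_dec x (1 / 2)).
- exists (x + Rmin (e / 2) (1 / 2)). split; [lra|]. split; [lra|].
  apply Rabs_def1; lra.
- exists (x - Rmin (e / 2) (1 / 2)). split; [lra|]. split; [lra|].
  apply Rabs_def1; lra.
Qed.

(** [Derive_on] is a definite description, so it can be computed only where the limit is unique;
    accumulation of [D] at [x] provides this. *)
Lemma Derive_on_eq (D : R -> Prop) (f : R -> R) (x l : R) :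
  accumulating D -> D x -> is_derive_on D f x l -> Derive_on D f x = l.
Proof. intros HD Dx; apply is_derive_on_unique; exact (HD x Dx). Qed.

Lemma Derive_on_correct (D : R -> Prop) (f : R -> R) (x : R) :
  accumulating D -> D x -> ex_derive_on D f x -> is_derive_on D f x (Derive_on D f x).
Proof. intros HD Dx [l Hl]. rewrite (Derive_on_eq D f x l); assumption. Qed.

Lemma is_derive_on_ext (D : R -> Prop) (f g : R -> R) (x l : R) :
  (forall y, D y -> f y = g y) -> D x -> is_derive_on D f x l -> is_derive_on D g x l.
Proof.
intros Hfg Dx. unfold is_derive_on. apply filterlim_within_ext.
intros y Dy. rewrite !Hfg; auto.
Qed.

Lemma Derive_on_ext (D : R -> Prop) (f g : R -> R) (x : R) :
  accumulating D -> (forall y, D y -> f y = g y) -> D x -> ex_derive_on D f x ->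
  Derive_on D g x = Derive_on D f x.
Proof.
intros HD Hfg Dx Hf. apply Derive_on_eq; auto.
apply is_derive_on_ext with f; auto. apply Derive_on_correct; auto.
Qed.

Lemma is_derive_on_within (D : R -> Prop) (f : R -> R) (x l : R) :
  is_derive f x l -> is_derive_on D f x l.
Proof.
intros Hf. apply is_derive_Reals in Hf. intros P [e He].
destruct (Hf e (cond_pos e)) as [d Hd].
exists d. intros y Hy yx _. apply He.
assert (H := Hd (y - x)). rewrite Rplus_minus in H.
apply H; [lra|exact Hy].
Qed.

Lemma is_derive_on_interior (D : R -> Prop) (f : R -> R) (x l : R) :
  locally x D -> is_derive_on D f x l -> is_derive f x l.
Proof.
intros [d0 HD] Hf. apply is_derive_Reals. intros e He.
destruct (Hf (ball l (mkposreal e He)) (locally_ball _ _)) as [d Hd].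
assert (Hm : 0 < Rmin d d0) by (apply Rmin_glb_lt; apply cond_pos).
exists (mkposreal _ Hm). simpl. intros h hn Hh.
assert (Hb : forall e' : posreal, Rmin d d0 <= e' -> ball x e' (x + h)).
{ intros e' He'. unfold ball; simpl; unfold AbsRing_ball, abs, minus, plus, opp; simpl.
  replace (x + h + - x) with h by ring. lra. }
assert (H := Hd (x + h) (Hb d (Rmin_l _ _))). simpl in H.
replace (x + h - x) with h in H by ring.
apply H; [lra|]. apply HD, Hb, Rmin_r.
Qed.

Lemma is_derive_on_minus (D : R -> Prop) (f g : R -> R) (x lf lg : R) :
  is_derive_on D f x lf -> is_derive_on D g x lg ->
  is_derive_on D (fun y => f y - g y) x (lf - lg).
Proof.
intros Hf Hg. unfold is_derive_on.
assert (Ho : filterlim (fun y => opp ((g y - g x) / (y - x))) (within D (locally' x)) (locally (opp lg))).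
{ eapply filterlim_comp; [exact Hg|]. apply (@filterlim_opp R_AbsRing R_NormedModule). }
apply filterlim_ext with (fun y => plus ((f y - f x) / (y - x)) (opp ((g y - g x) / (y - x)))).
{ intros y. unfold plus, opp; simpl. unfold Rdiv; ring. }
apply (filterlim_comp_2 _ _ (fun a b : R => plus a b) Hf Ho).
apply (@filterlim_plus R_AbsRing R_NormedModule).
Qed.

Lemma continuous_on_minus {T : UniformSpace} (D : T -> Prop) (f g : T -> R) :
  continuous_on D f -> continuous_on D g -> continuous_on D (fun p => f p - g p).
Proof.
intros Hf Hg p Dp.
assert (Ho : filterlim (fun q => opp (g q)) (within D (locally p)) (locally (opp (g p)))).
{ eapply filterlim_comp; [exact (Hg p Dp)|]. apply (@filterlim_opp R_AbsRing R_NormedModule). }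
apply (filterlim_comp_2 _ _ (fun a b : R => plus a b) (Hf p Dp) Ho).
apply (@filterlim_plus R_AbsRing R_NormedModule).
Qed.

Lemma Ck_on_ext (k : nat) (D : R -> Prop) (f g : R -> R) :
  accumulating D -> (forall x, D x -> f x = g x) -> Ck_on k D f -> Ck_on k D g.
Proof.
intros HD. revert f g. induction k as [|k IH]; intros f g Hfg [Hc Hk].
- split; [|exact I]. apply continuous_on_ext with f; assumption.
- destruct Hk as [He Hk]. split; [apply continuous_on_ext with f; assumption|]. split.
  + intros x Dx. destruct (He x Dx) as [l Hl]. exists l.
    apply is_derive_on_ext with f; assumption.
  + apply IH with (Derive_on D f); [|exact Hk].
    intros x Dx. symmetry. apply Derive_on_ext; auto.
Qed.

(** [Ck_on] iterates [Derive_on D f], whose values off [D] are arbitrary. Here an explicit formula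
    takes its place, so that smoothness of a concrete family follows by induction. *)
Lemma Ck_on_S (k : nat) (D : R -> Prop) (f df : R -> R) :
  accumulating D -> continuous_on D f -> (forall x, D x -> is_derive_on D f x (df x)) ->
  Ck_on k D df -> Ck_on (S k) D f.
Proof.
intros HD Hc Hd Hk. split; [exact Hc|]. split.
- intros x Dx. exists (df x). auto.
- apply Ck_on_ext with df; auto. intros x Dx. symmetry. apply Derive_on_eq; auto.
Qed.

Lemma Dt_ext (u v : R -> R -> R) (t x : R) :
  (forall s, half_line s -> u s x = v s x) -> half_line t ->
  ex_derive_on half_line (fun s => u s x) t -> Dt v t x = Dt u t x.
Proof. intros. apply (Derive_on_ext half_line (fun s => u s x) (fun s => v s x)); auto using accumulating_half_line. Qed.

Lemma Dx_ext (u v : R -> R -> R) (t x : R) :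
  (forall y, unit_interval y -> u t y = v t y) -> unit_interval x ->
  ex_derive_on unit_interval (u t) x -> Dx v t x = Dx u t x.
Proof. intros. apply (Derive_on_ext unit_interval (u t) (v t)); auto using accumulating_unit_interval. Qed.

Lemma Ck_strip_ext (k : nat) (u v : R -> R -> R) :
  (forall t x, half_line t -> unit_interval x -> u t x = v t x) -> Ck_strip k u -> Ck_strip k v.
Proof.
revert u v. induction k as [|k IH]; intros u v Huv [Hc Hk].
- split; [|exact I]. eapply continuous_on_ext; [|exact Hc].
  intros p [H1 H2]. simpl. auto.
- destruct Hk as [He [Ht Hx]].
  split; [eapply continuous_on_ext; [|exact Hc]; intros p [H1 H2]; simpl; auto|].
  split; [|split].
  + intros t x Tt Xx. destruct (He t x Tt Xx) as [[l Hl] [m Hm]]. split; [exists l|exists m].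
    * apply is_derive_on_ext with (fun s => u s x); auto.
    * apply is_derive_on_ext with (u t); auto.
  + apply IH with (Dt u); [|exact Ht]. intros t x Tt Xx. symmetry. apply Dt_ext; auto. apply He; auto.
  + apply IH with (Dx u); [|exact Hx]. intros t x Tt Xx. symmetry. apply Dx_ext; auto. apply He; auto.
Qed.

Lemma Ck_strip_S (k : nat) (u ut ux : R -> R -> R) :
  continuous_on strip (fun p : R * R => u (fst p) (snd p)) ->
  (forall t x, half_line t -> unit_interval x -> is_derive_on half_line (fun s => u s x) t (ut t x)) ->
  (forall t x, half_line t -> unit_interval x -> is_derive_on unit_interval (u t) x (ux t x)) ->
  Ck_strip k ut -> Ck_strip k ux -> Ck_strip (S k) u.
Proof.
intros Hc Ht Hx Kt Kx. split; [exact Hc|]. split; [|split].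
- intros t x Tt Xx. split; [exists (ut t x)|exists (ux t x)]; auto.
- apply Ck_strip_ext with ut; auto. intros t x Tt Xx. symmetry.
  apply Derive_on_eq; auto using accumulating_half_line.
- apply Ck_strip_ext with ux; auto. intros t x Tt Xx. symmetry.
  apply Derive_on_eq; auto using accumulating_unit_interval.
Qed.

(** * Extension from the strip to the plane *)

(* A function on the closed strip is extended to the whole plane through the
   nearest-point projection, so that the two-sided calculus of Coquelicot applies. *)
Definition clamp (x : R) : R := Rmax 0 (Rmin 1 x).

Definition extend (F : R -> R -> R) (t x : R) : R := F (Rmax 0 t) (clamp x).

Lemma clamp_unit (x : R) : unit_interval (clamp x).
Proof.
unfold clamp, unit_interval. split; [apply Rmax_l|].
apply Rmax_lub; [lra|apply Rmin_l].
Qed.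

Lemma clamp_id (x : R) : unit_interval x -> clamp x = x.
Proof. intros [H0 H1]. unfold clamp. rewrite Rmin_right, Rmax_right; lra. Qed.

Lemma Rmax_half_line (t : R) : half_line (Rmax 0 t).
Proof. apply Rmax_l. Qed.

Lemma extend_id (F : R -> R -> R) (t x : R) :
  half_line t -> unit_interval x -> extend F t x = F t x.
Proof.
intros Ht Hx. unfold extend. rewrite clamp_id by assumption.
rewrite Rmax_right; [reflexivity|exact Ht].
Qed.

Lemma Rmax_0_contract (s t : R) : Rabs (Rmax 0 s - Rmax 0 t) <= Rabs (s - t).
Proof.
unfold Rmax. destruct (Rle_dec 0 s), (Rle_dec 0 t);
unfold Rabs; repeat destruct Rcase_abs; lra.
Qed.

Lemma clamp_contract (x y : R) : Rabs (clamp x - clamp y) <= Rabs (x - y).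
Proof.
eapply Rle_trans; [apply Rmax_0_contract|].
unfold Rmin. destruct (Rle_dec 1 x), (Rle_dec 1 y);
unfold Rabs; repeat destruct Rcase_abs; lra.
Qed.

(** The projection is 1-Lipschitz in each variable, so a relative neighbourhood of the projected
    point pulls back with the same radius. *)
Lemma extend_continuity (F : R -> R -> R) (t x : R) :
  continuous_on strip (fun p : R * R => F (fst p) (snd p)) -> continuity_2d_pt (extend F) t x.
Proof.
intros HF e.
assert (Hp : strip (Rmax 0 t, clamp x)) by (split; [apply Rmax_half_line|apply clamp_unit]).
destruct (HF _ Hp _ (locally_ball _ e)) as [d Hd].
exists d. intros s y Hs Hy. apply (Hd (Rmax 0 s, clamp y)).
- split; simpl.
  + apply Rle_lt_trans with (2 := Hs), Rmax_0_contract.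
  + apply Rle_lt_trans with (2 := Hy), clamp_contract.
- split; [apply Rmax_half_line|apply clamp_unit].
Qed.

Lemma clamp_continuous_on (f : R -> R) (x : R) :
  continuous_on unit_interval f -> continuous (fun y => f (clamp y)) x.
Proof.
intros Hf P [e HP].
destruct (Hf _ (clamp_unit x) _ (locally_ball _ e)) as [d Hd].
exists d. intros y Hy. apply HP, Hd; [|apply clamp_unit].
apply Rle_lt_trans with (2 := Hy), clamp_contract.
Qed.

Lemma continuity_2d_continuous_snd (F : R -> R -> R) (t x : R) :
  continuity_2d_pt F t x -> continuous (F t) x.
Proof.
intros HF P [e HP]. destruct (HF e) as [d Hd]. exists d. intros y Hy.
apply HP, Hd; [|exact Hy]. rewrite Rminus_diag, Rabs_R0. apply cond_pos.
Qed.

Lemma continuity_2d_continuous_fst (F : R -> R -> R) (t x : R) :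
  continuity_2d_pt F t x -> continuous (fun s => F s x) t.
Proof.
intros HF P [e HP]. destruct (HF e) as [d Hd]. exists d. intros y Hy.
apply HP, Hd; [exact Hy|]. rewrite Rminus_diag, Rabs_R0. apply cond_pos.
Qed.

Lemma locally_half_line (t : R) : 0 < t -> locally t half_line.
Proof.
intros Ht. apply filter_imp with (fun s => 0 < s).
- intros s Hs. unfold half_line. lra.
- apply open_gt. exact Ht.
Qed.

Lemma locally_unit_open (x : R) : 0 < x < 1 -> locally x (fun y => 0 < y < 1).
Proof.
intros [H0 H1]. apply filter_and; [apply open_gt; exact H0|apply open_lt; exact H1].
Qed.

Lemma locally_unit_interval (x : R) : 0 < x < 1 -> locally x unit_interval.
Proof.
intros Hx. apply filter_imp with (2 := locally_unit_open x Hx).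
intros y Hy. unfold unit_interval. lra.
Qed.

(** In [x] the extension merely evaluates at a clamped point, so any [x] is allowed; in [t] it is
    constant for negative times and may have a kink at 0. *)
Lemma extend_is_derive_t (F G : R -> R -> R) (t x : R) :
  (forall s y, half_line s -> unit_interval y -> is_derive_on half_line (fun s' => F s' y) s (G s y)) ->
  0 < t -> is_derive (fun s => extend F s x) t (extend G t x).
Proof.
intros HF Ht. unfold extend at 2. rewrite Rmax_right by lra.
apply is_derive_ext_loc with (fun s => F s (clamp x)).
- apply filter_imp with (2 := locally_half_line t Ht). intros s Hs.
  unfold extend. rewrite Rmax_right; [reflexivity|exact Hs].
- apply is_derive_on_interior with half_line; [apply locally_half_line, Ht|].
  apply HF; [unfold half_line; lra|apply clamp_unit].
Qed.

Lemma clamp_is_derive (f g : R -> R) (x : R) :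
  (forall y, unit_interval y -> is_derive_on unit_interval f y (g y)) ->
  0 < x < 1 -> is_derive (fun y => f (clamp y)) x (g (clamp x)).
Proof.
intros Hf Hx. rewrite clamp_id by (unfold unit_interval; lra).
apply is_derive_ext_loc with f.
- apply filter_imp with (2 := locally_unit_interval x Hx). intros y Hy.
  rewrite clamp_id; [reflexivity|exact Hy].
- apply is_derive_on_interior with unit_interval; [apply locally_unit_interval, Hx|].
  apply Hf. unfold unit_interval. lra.
Qed.

(** * Integrals and mixed derivatives when differentiability is known on open sets only *)

Lemma RInt_derive_open (f g : R -> R) (a b : R) :
  a < b -> (forall x, continuous f x) -> (forall x, continuous g x) ->
  (forall x, a < x < b -> is_derive f x (g x)) -> RInt g a b = f b - f a.
Proof.
intros Hab Hf Hg Hd.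
assert (HG : forall x, is_derive (RInt g a) x (g x)).
{ intros x. apply is_derive_RInt with a; [|apply Hg].
  apply filter_forall. intros y. apply (@RInt_correct R_CompleteNormedModule).
  apply (@ex_RInt_continuous R_CompleteNormedModule). intros; apply Hg. }
(* The mean value theorem asks for derivatives inside and continuity up to the ends, which tolerates
   the kinks of clamped functions at the end points. *)
destruct (MVT_gen (fun x => f x - RInt g a x) a b (fun _ => 0)) as [c [_ Hc]].
- intros x Hx. rewrite Rmin_left, Rmax_right in Hx by lra.
  replace 0 with (g x - g x) by ring.
  apply (@is_derive_minus R_AbsRing R_NormedModule); auto.
- intros x _. apply continuity_pt_filterlim.
  apply (continuous_minus f (RInt g a) x); [apply Hf|].
  apply ex_derive_continuous. exists (g x). apply HG.
- rewrite RInt_point in Hc. change (@zero R_CompleteNormedModule) with 0 in Hc. lra.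
Qed.

(** Both pieces of the integral, before and after y, are nonnegative with sum 0; the integral up to
    y is therefore identically 0, and [f] is its derivative. *)
Lemma RInt_zero_continuous (f : R -> R) (a b x : R) :
  (forall y, continuous f y) -> (forall y, 0 <= f y) -> RInt f a b = 0 ->
  a < x < b -> f x = 0.
Proof.
intros Hc Hp H0 Hx.
assert (Hex : forall c d, ex_RInt f c d).
{ intros c d. apply (@ex_RInt_continuous R_CompleteNormedModule). intros; apply Hc. }
assert (HF : forall y, a < y < b -> RInt f a y = 0).
{ intros y Hy. assert (Hch := RInt_Chasles f a y b (Hex _ _) (Hex _ _)).
  unfold plus in Hch; simpl in Hch.
  assert (H1 : 0 <= RInt f a y) by (apply RInt_ge_0; [lra|apply Hex|intros; apply Hp]).
  assert (H2 : 0 <= RInt f y b) by (apply RInt_ge_0; [lra|apply Hex|intros; apply Hp]).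
  lra. }
assert (HD : is_derive (RInt f a) x (f x)).
{ apply is_derive_RInt with a; [|apply Hc].
  apply filter_forall. intros y. apply (@RInt_correct R_CompleteNormedModule), Hex. }
apply is_derive_unique in HD. rewrite <- HD.
rewrite (Derive_ext_loc (RInt f a) (fun _ => 0)); [apply Derive_const|].
apply filter_imp with (fun y => a < y /\ y < b).
- intros y Hy. apply HF, Hy.
- apply filter_and; [apply open_gt|apply open_lt]; lra.
Qed.

Lemma RInt_param_continuous (f : R -> R -> R) (a b t : R) :
  a <= b -> (forall s x, continuity_2d_pt f s x) -> continuous (fun s => RInt (f s) a b) t.
Proof.
intros Hab Hf P [e HP].
assert (Hex : forall s, ex_RInt (f s) a b).
{ intros s. apply (@ex_RInt_continuous R_CompleteNormedModule). intros x _.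
  apply continuity_2d_continuous_snd, Hf. }
(* The added 1 covers [a = b] and makes the final bound by [e] strict. *)
assert (He : 0 < e / (b - a + 1)) by (apply Rdiv_lt_0_compat; [apply cond_pos|lra]).
destruct (uniform_continuity_2d_1d' f a b t (fun x _ => Hf t x) (mkposreal _ He)) as [d Hd].
exists d. intros s Hs. apply HP.
change (Rabs (RInt (f s) a b - RInt (f t) a b) < e).
change (Rabs (s - t) < d) in Hs.
assert (Hi := RInt_minus (f s) (f t) a b (Hex s) (Hex t)).
unfold minus, plus, opp in Hi; simpl in Hi.
unfold Rminus at 1. rewrite <- Hi.
apply Rle_lt_trans with ((b - a) * (e / (b - a + 1))).
- apply abs_RInt_le_const; [exact Hab|apply (@ex_RInt_minus R_NormedModule); apply Hex|].
  intros x Hx. apply Rlt_le.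
  assert (Hd0 := cond_pos d). apply Rabs_def2 in Hs.
  apply (Hd x t x s); try lra. rewrite Rminus_diag, Rabs_R0. lra.
- assert (He' : (b - a + 1) * (e / (b - a + 1)) = e) by (field; lra).
  simpl in *. nra.
Qed.

Lemma RInt_param_derive (f df : R -> R -> R) (a b t : R) :
  (forall s x, continuity_2d_pt f s x) -> (forall s x, continuity_2d_pt df s x) ->
  (forall s x, 0 < s -> is_derive (fun s' => f s' x) s (df s x)) -> 0 < t ->
  is_derive (fun s => RInt (f s) a b) t (RInt (df t) a b).
Proof.
intros Hf Hdf Hd Ht.
replace (RInt (df t) a b) with (RInt (fun x => Derive (fun s => f s x) t) a b).
2:{ apply RInt_ext. intros x _. apply is_derive_unique, Hd, Ht. }
apply is_derive_RInt_param.
- apply filter_imp with (2 := open_gt 0 t Ht). intros s Hs x _. exists (df s x). apply Hd, Hs.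
- intros x _. apply continuity_2d_pt_ext_loc with df; [|apply Hdf].
  (* Radius [t] keeps [s] positive, where [df] is the derivative. *)
  exists (mkposreal t Ht). simpl. intros s y Hs _. symmetry.
  apply is_derive_unique, Hd. apply Rabs_def2 in Hs. lra.
- apply filter_forall. intros s. apply (@ex_RInt_continuous R_CompleteNormedModule). intros x _.
  apply continuity_2d_continuous_snd, Hf.
Qed.

(** [Schwarz] speaks of nested [Derive] terms. Since [w] and [z] are the first derivatives on a
    whole neighbourhood, the nested terms coincide there with [zt] and [wx]. *)
Lemma Schwarz_open (u w z zt wx : R -> R -> R) (t x : R) :
  locally_2d (fun s y => is_derive (fun s' => u s' y) s (w s y) /\ is_derive (u s) y (z s y)
    /\ is_derive (fun s' => z s' y) s (zt s y) /\ is_derive (w s) y (wx s y)) t x ->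
  continuity_2d_pt zt t x -> continuity_2d_pt wx t x -> zt t x = wx t x.
Proof.
intros HU Hzt Hwx.
assert (Hzt' : locally_2d (fun s y => is_derive (fun s' => Derive (fun y' => u s' y') y) s (zt s y)) t x).
{ apply locally_2d_impl_strong with (2 := HU). apply locally_2d_forall. intros s y H.
  assert (H' := locally_2d_singleton _ _ _ H).
  apply is_derive_ext_loc with (fun s' => z s' y); [|apply H'].
  apply locally_2d_1d_const_y in H. apply filter_imp with (2 := H).
  intros s' Hs'. symmetry. apply is_derive_unique, Hs'. }
assert (Hwx' : locally_2d (fun s y => is_derive (fun y' => Derive (fun s' => u s' y') s) y (wx s y)) t x).
{ apply locally_2d_impl_strong with (2 := HU). apply locally_2d_forall. intros s y H.
  assert (H' := locally_2d_singleton _ _ _ H).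
  apply is_derive_ext_loc with (w s); [|apply H'].
  apply locally_2d_1d_const_x in H. apply filter_imp with (2 := H).
  intros s' Hs'. symmetry. apply is_derive_unique, Hs'. }
rewrite <- (is_derive_unique _ _ _ (locally_2d_singleton _ _ _ Hzt')).
rewrite <- (is_derive_unique _ _ _ (locally_2d_singleton _ _ _ Hwx')).
apply Schwarz.
- apply locally_2d_and with (1 := HU) in Hzt'. apply locally_2d_and with (1 := Hzt') in Hwx'.
  apply locally_2d_impl with (2 := Hwx'). apply locally_2d_forall.
  intros s y [[[H1 [H2 _]] H3] H4].
  repeat split; eexists; [exact H1|exact H2|exact H3|exact H4].
- apply continuity_2d_pt_ext_loc with zt; [|exact Hzt].
  apply locally_2d_impl with (2 := Hzt'). apply locally_2d_forall.
  intros s y H. symmetry. apply is_derive_unique, H.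
- apply continuity_2d_pt_ext_loc with wx; [|exact Hwx].
  apply locally_2d_impl with (2 := Hwx'). apply locally_2d_forall.
  intros s y H. symmetry. apply is_derive_unique, H.
Qed.

(** * Uniqueness of solutions *)

(* The names of the arguments are those of the partial derivatives: w = u_t and z = u_x;
   no mixed derivative is assumed symmetric. *)
Record regular (u w z wt wx zt zx wxx : R -> R -> R) : Prop := {
  reg_u : continuous_on strip (fun p : R * R => u (fst p) (snd p));
  reg_w : continuous_on strip (fun p : R * R => w (fst p) (snd p));
  reg_z : continuous_on strip (fun p : R * R => z (fst p) (snd p));
  reg_wt : continuous_on strip (fun p : R * R => wt (fst p) (snd p));
  reg_wx : continuous_on strip (fun p : R * R => wx (fst p) (snd p));
  reg_zt : continuous_on strip (fun p : R * R => zt (fst p) (snd p));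
  reg_zx : continuous_on strip (fun p : R * R => zx (fst p) (snd p));
  reg_wxx : forall t, half_line t -> continuous_on unit_interval (wxx t);
  reg_u_t : forall t x, half_line t -> unit_interval x -> is_derive_on half_line (fun s => u s x) t (w t x);
  reg_u_x : forall t x, half_line t -> unit_interval x -> is_derive_on unit_interval (u t) x (z t x);
  reg_w_t : forall t x, half_line t -> unit_interval x -> is_derive_on half_line (fun s => w s x) t (wt t x);
  reg_w_x : forall t x, half_line t -> unit_interval x -> is_derive_on unit_interval (w t) x (wx t x);
  reg_z_t : forall t x, half_line t -> unit_interval x -> is_derive_on half_line (fun s => z s x) t (zt t x);
  reg_z_x : forall t x, half_line t -> unit_interval x -> is_derive_on unit_interval (z t) x (zx t x);
  reg_wx_x : forall t x, half_line t -> unit_interval x -> is_derive_on unit_interval (wx t) x (wxx t x)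
}.

Lemma regular_minus u1 w1 z1 wt1 wx1 zt1 zx1 wxx1 u2 w2 z2 wt2 wx2 zt2 zx2 wxx2 :
  regular u1 w1 z1 wt1 wx1 zt1 zx1 wxx1 -> regular u2 w2 z2 wt2 wx2 zt2 zx2 wxx2 ->
  regular (fun t x => u1 t x - u2 t x) (fun t x => w1 t x - w2 t x)
    (fun t x => z1 t x - z2 t x) (fun t x => wt1 t x - wt2 t x)
    (fun t x => wx1 t x - wx2 t x) (fun t x => zt1 t x - zt2 t x)
    (fun t x => zx1 t x - zx2 t x) (fun t x => wxx1 t x - wxx2 t x).
Proof.
intros [] []. split; intros.
1-8: (apply (@continuous_on_minus (prod_UniformSpace R_UniformSpace R_UniformSpace)); assumption) || (apply (@continuous_on_minus R_UniformSpace); auto).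
all: apply is_derive_on_minus; auto.
Qed.

Lemma Dt_correct (u : R -> R -> R) (t x : R) :
  half_line t -> ex_derive_on half_line (fun s => u s x) t ->
  is_derive_on half_line (fun s => u s x) t (Dt u t x).
Proof. exact (Derive_on_correct half_line _ t accumulating_half_line). Qed.

Lemma Dx_correct (u : R -> R -> R) (t x : R) :
  unit_interval x -> ex_derive_on unit_interval (u t) x ->
  is_derive_on unit_interval (u t) x (Dx u t x).
Proof. exact (Derive_on_correct unit_interval _ x accumulating_unit_interval). Qed.

Lemma Ck_strip_2_regular (u : R -> R -> R) :
  Ck_strip 2 u -> (forall t, half_line t -> Ck_on 2 unit_interval (Dt u t)) ->
  regular u (Dt u) (Dx u) (Dt (Dt u)) (Dx (Dt u)) (Dt (Dx u)) (Dx (Dx u)) (Dx (Dx (Dt u))).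
Proof.
intros [Hu [Hd [[Hw [Hwd [[Hwt _] [Hwx _]]]] [Hz [Hzd [[Hzt _] [Hzx _]]]]]]] Hk.
split; try assumption.
(* The innermost layer of [Ck_on 2] for the velocity profile: continuity in x of its second
   derivative. *)
- intros t Ht. exact (proj1 (proj2 (proj2 (proj2 (proj2 (Hk t Ht)))))).
- intros t x Ht Hx. exact (Dt_correct u t x Ht (proj1 (Hd t x Ht Hx))).
- intros t x Ht Hx. exact (Dx_correct u t x Hx (proj2 (Hd t x Ht Hx))).
- intros t x Ht Hx. exact (Dt_correct (Dt u) t x Ht (proj1 (Hwd t x Ht Hx))).
- intros t x Ht Hx. exact (Dx_correct (Dt u) t x Hx (proj2 (Hwd t x Ht Hx))).
- intros t x Ht Hx. exact (Dt_correct (Dx u) t x Ht (proj1 (Hzd t x Ht Hx))).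
- intros t x Ht Hx. exact (Dx_correct (Dx u) t x Hx (proj2 (Hzd t x Ht Hx))).
- intros t x Ht Hx. exact (Dx_correct (Dx (Dt u)) t x Hx (proj1 (proj2 (proj2 (proj2 (Hk t Ht)))) x Hx)).
Qed.

(* Integrand = d/dx [2 w (z + sigma w_x)] - 2 sigma w_x^2 - 2 mu w^2, and w vanishes
   at both ends. *)
Lemma zero_data_energy u w z wt wx zt zx wxx sigma mu :
  0 < sigma -> 0 <= mu -> regular u w z wt wx zt zx wxx ->
  (forall t x, 0 < t -> 0 < x < 1 -> wt t x = zx t x + sigma * wxx t x - mu * w t x) ->
  (forall t, half_line t -> u t 0 = 0 /\ u t 1 = 0) ->
  forall t, 0 < t ->
  RInt (fun x => 2 * (extend w t x * extend wt t x) + 2 * (extend z t x * extend zt t x)) 0 1 <= 0.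
Proof.
intros Hs Hm Reg Hpde Hbd t Ht.
assert (Tt : half_line t) by (unfold half_line; lra).
(* The velocity at an end point is the time derivative of a trace that is identically 0. *)
assert (Hwb : forall x, x = 0 \/ x = 1 -> w t x = 0).
{ intros x Hx. assert (Ux : unit_interval x) by (unfold unit_interval; lra).
  rewrite <- (Derive_on_eq half_line (fun s => u s x) t (w t x)); auto using accumulating_half_line.
  2: apply (reg_u_t _ _ _ _ _ _ _ _ Reg); assumption.
  apply Derive_on_eq; auto using accumulating_half_line.
  apply is_derive_on_ext with (fun _ => 0); auto.
  - intros s Ts. symmetry. destruct Hx; subst; apply Hbd; assumption.
  - apply is_derive_on_within. apply (@is_derive_const R_AbsRing R_NormedModule). }
assert (Cw : forall x, continuous (extend w t) x) by (intros; apply continuity_2d_continuous_snd, extend_continuity, Reg).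
assert (Cz : forall x, continuous (extend z t) x) by (intros; apply continuity_2d_continuous_snd, extend_continuity, Reg).
assert (Cwt : forall x, continuous (extend wt t) x) by (intros; apply continuity_2d_continuous_snd, extend_continuity, Reg).
assert (Cwx : forall x, continuous (extend wx t) x) by (intros; apply continuity_2d_continuous_snd, extend_continuity, Reg).
assert (Czt : forall x, continuous (extend zt t) x) by (intros; apply continuity_2d_continuous_snd, extend_continuity, Reg).
assert (Czx : forall x, continuous (extend zx t) x) by (intros; apply continuity_2d_continuous_snd, extend_continuity, Reg).
assert (Cwxx : forall x, continuous (extend wxx t) x).
{ intros x. apply clamp_continuous_on. rewrite Rmax_right by lra. apply Reg, Tt. }
assert (Dw : forall x, 0 < x < 1 -> is_derive (extend w t) x (extend wx t x)).
{ intros x Hx. apply clamp_is_derive; [|exact Hx]. intros y Hy. apply Reg; [apply Rmax_half_line|exact Hy]. }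
assert (Dz : forall x, 0 < x < 1 -> is_derive (extend z t) x (extend zx t x)).
{ intros x Hx. apply clamp_is_derive; [|exact Hx]. intros y Hy. apply Reg; [apply Rmax_half_line|exact Hy]. }
assert (Dwx : forall x, 0 < x < 1 -> is_derive (extend wx t) x (extend wxx t x)).
{ intros x Hx. apply clamp_is_derive; [|exact Hx]. intros y Hy. apply Reg; [apply Rmax_half_line|exact Hy]. }
assert (Hsym : forall x, 0 < x < 1 -> extend zt t x = extend wx t x).
{ intros x Hx.
  apply (Schwarz_open (extend u) (extend w) (extend z)); try apply extend_continuity, Reg.
  destruct (locally_unit_open x Hx) as [d1 Hd1].
  (* This radius keeps the neighbourhood inside the open strip, away from the kinks of the
     extensions. *)
  assert (Hd : 0 < Rmin d1 t) by (apply Rmin_glb_lt; [apply cond_pos|exact Ht]).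
  exists (mkposreal _ Hd). simpl. intros s y Hsd Hyd.
  assert (Hs0 : 0 < s).
  { apply Rabs_def2 in Hsd. assert (Hr := Rmin_r d1 t). lra. }
  assert (Hy : 0 < y < 1).
  { apply Hd1. apply Rlt_le_trans with (1 := Hyd), Rmin_l. }
  split; [|split; [|split]].
  - apply extend_is_derive_t; [intros; apply Reg; assumption|exact Hs0].
  - apply clamp_is_derive; [|exact Hy]. intros y' Hy'. apply Reg; [apply Rmax_half_line|exact Hy'].
  - apply extend_is_derive_t; [intros; apply Reg; assumption|exact Hs0].
  - apply clamp_is_derive; [|exact Hy]. intros y' Hy'. apply Reg; [apply Rmax_half_line|exact Hy']. }
pose (h := fun x => 2 * (extend w t x * (extend z t x + sigma * extend wx t x))).
pose (dh := fun x => 2 * (extend wx t x * (extend z t x + sigma * extend wx t x)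
                        + extend w t x * (extend zx t x + sigma * extend wxx t x))).
assert (Ch : forall x, continuous h x).
{ intros x. unfold h.
  apply (continuous_scal_r (V := R_NormedModule) 2), (continuous_mult (K := R_AbsRing)); auto.
  apply (continuous_plus (V := R_NormedModule)); auto.
  apply (continuous_scal_r (V := R_NormedModule) sigma); auto. }
assert (Cdh : forall x, continuous dh x).
{ intros x. unfold dh.
  apply (continuous_scal_r (V := R_NormedModule) 2), (continuous_plus (V := R_NormedModule));
  apply (continuous_mult (K := R_AbsRing)); auto;
  apply (continuous_plus (V := R_NormedModule)); auto;
  apply (continuous_scal_r (V := R_NormedModule) sigma); auto. }
assert (HI : RInt dh 0 1 = h 1 - h 0).
{ apply RInt_derive_open; auto; [lra|]. intros x Hx. unfold h, dh.
  assert (D1 := Dw x Hx). assert (D2 := Dz x Hx). assert (D3 := Dwx x Hx).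
  assert (D4 : is_derive (fun y => extend z t y + sigma * extend wx t y) x (extend zx t x + sigma * extend wxx t x)).
  { apply (is_derive_plus (K := R_AbsRing) (V := R_NormedModule)); [exact D2|].
    apply is_derive_scal, D3. }
  apply is_derive_scal.
  apply (is_derive_mult (K := R_AbsRing) _ _ x _ _ D1 D4). intros; apply Rmult_comm. }
assert (Hh : h 1 - h 0 = 0).
{ unfold h. rewrite !(extend_id w); try (unfold unit_interval; lra); auto.
  rewrite !Hwb by auto. ring. }
apply Rle_trans with (RInt dh 0 1); [|rewrite HI, Hh; apply Rle_refl].
apply RInt_le; [lra| | |].
- apply (@ex_RInt_continuous R_CompleteNormedModule). intros x _.
  apply (continuous_plus (V := R_NormedModule));
  apply (continuous_scal_r (V := R_NormedModule) 2), (continuous_mult (K := R_AbsRing)); auto.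
- apply (@ex_RInt_continuous R_CompleteNormedModule). intros x _. apply Cdh.
- intros x Hx. unfold dh. rewrite Hsym by assumption.
  assert (Ux : unit_interval x) by (unfold unit_interval; lra).
  rewrite !extend_id by assumption. rewrite Hpde by assumption.
  assert (H1 := Rmult_le_pos _ _ (Rlt_le _ _ Hs) (pow2_ge_0 (wx t x))).
  assert (H2 := Rmult_le_pos _ _ Hm (pow2_ge_0 (w t x))).
  nra.
Qed.

(** The energy starts at 0, is continuous down to time 0 and cannot increase, so it vanishes. Thus
    the velocity is 0 inside, and the displacement keeps its initial value 0. *)
Lemma zero_data_solution u w z wt wx zt zx wxx sigma mu :
  0 < sigma -> 0 <= mu -> regular u w z wt wx zt zx wxx ->
  (forall t x, 0 < t -> 0 < x < 1 -> wt t x = zx t x + sigma * wxx t x - mu * w t x) ->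
  (forall t, half_line t -> u t 0 = 0 /\ u t 1 = 0) ->
  (forall x, unit_interval x -> u 0 x = 0 /\ w 0 x = 0) ->
  forall t x, half_line t -> unit_interval x -> u t x = 0.
Proof.
intros Hs Hm Reg Hpde Hbd Hini.
assert (T0 : half_line 0) by (unfold half_line; lra).
assert (Hz0 : forall x, unit_interval x -> z 0 x = 0).
{ intros x Ux.
  rewrite <- (Derive_on_eq unit_interval (u 0) x (z 0 x)); auto using accumulating_unit_interval.
  2: apply (reg_u_x _ _ _ _ _ _ _ _ Reg); assumption.
  apply Derive_on_eq; auto using accumulating_unit_interval.
  apply is_derive_on_ext with (fun _ => 0); auto.
  - intros y Uy. symmetry. apply Hini, Uy.
  - apply is_derive_on_within. apply (@is_derive_const R_AbsRing R_NormedModule). }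
pose (e := fun t x => extend w t x * extend w t x + extend z t x * extend z t x).
pose (de := fun t x => 2 * (extend w t x * extend wt t x) + 2 * (extend z t x * extend zt t x)).
assert (Ce : forall t x, continuity_2d_pt e t x).
{ intros t x. apply continuity_2d_pt_plus; apply continuity_2d_pt_mult; apply extend_continuity, Reg. }
assert (Cde : forall t x, continuity_2d_pt de t x).
{ intros t x. apply continuity_2d_pt_plus; apply continuity_2d_pt_mult;
  try apply continuity_2d_pt_const; apply continuity_2d_pt_mult; apply extend_continuity, Reg. }
assert (De : forall t x, 0 < t -> is_derive (fun s => e s x) t (de t x)).
{ intros t x Ht. unfold e, de.
  assert (D1 : is_derive (fun s => extend w s x) t (extend wt t x))
    by (apply extend_is_derive_t; [intros; apply Reg; assumption|exact Ht]).
  assert (D2 : is_derive (fun s => extend z s x) t (extend zt t x))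
    by (apply extend_is_derive_t; [intros; apply Reg; assumption|exact Ht]).
  replace (2 * (extend w t x * extend wt t x) + 2 * (extend z t x * extend zt t x))
    with ((extend wt t x * extend w t x + extend w t x * extend wt t x)
          + (extend zt t x * extend z t x + extend z t x * extend zt t x)) by ring.
  apply (is_derive_plus (K := R_AbsRing) (V := R_NormedModule));
  [apply (is_derive_mult (K := R_AbsRing) _ _ t _ _ D1 D1)|apply (is_derive_mult (K := R_AbsRing) _ _ t _ _ D2 D2)];
  intros; apply Rmult_comm. }
assert (HE0 : RInt (e 0) 0 1 = 0).
{ rewrite (RInt_ext (e 0) (fun _ => 0)).
  - rewrite RInt_const. unfold scal; simpl; unfold mult; simpl. ring.
  - intros x Hx. rewrite Rmin_left, Rmax_right in Hx by lra.
    assert (Ux : unit_interval x) by (unfold unit_interval; lra).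
    unfold e. rewrite !extend_id by assumption.
    rewrite Hz0 by assumption. rewrite (proj2 (Hini x Ux)).
    change (0 * 0 + 0 * 0 = 0). ring. }
assert (Hw : forall t x, 0 < t -> 0 < x < 1 -> extend w t x = 0).
{ intros t x Ht Hx.
  assert (Hpos : forall y, 0 <= e t y).
  { intros y. unfold e. nra. }
  assert (Cet : forall y, continuous (e t) y) by (intros; apply continuity_2d_continuous_snd, Ce).
  (* [MVT_gen] locates [c] in the closed interval, possibly at 0, where the energy inequality is not
     established. The [Rmin] agrees with the true derivative at positive times and is nonpositive at
     [c] in every case. *)
  destruct (MVT_gen (fun s => RInt (e s) 0 1) 0 t (fun s => Rmin 0 (RInt (de s) 0 1))) as [c [_ Hc]].
  - intros s Hst. rewrite Rmin_left in Hst by lra.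
    rewrite Rmin_right.
    + apply RInt_param_derive; auto. apply Hst.
    + apply (zero_data_energy u w z wt wx zt zx wxx sigma mu); auto. apply Hst.
  - intros s _. apply continuity_pt_filterlim. apply (RInt_param_continuous e); [lra|exact Ce].
  - assert (Hle : RInt (e t) 0 1 <= 0).
    { assert (Hr := Rmin_l 0 (RInt (de c) 0 1)). simpl in Hc. nra. }
    assert (Hge : 0 <= RInt (e t) 0 1).
    { apply RInt_ge_0; [lra| |intros; apply Hpos].
      apply (@ex_RInt_continuous R_CompleteNormedModule). intros; apply Cet. }
    assert (He : e t x = 0) by (apply (RInt_zero_continuous (e t) 0 1); auto; lra).
    unfold e in He. nra. }
intros t x Tt Ux.
destruct (Req_dec x 0) as [->|Hx0]; [apply Hbd, Tt|].
destruct (Req_dec x 1) as [->|Hx1]; [apply Hbd, Tt|].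
assert (Hx : 0 < x < 1) by (unfold unit_interval in Ux; lra).
rewrite <- (extend_id u t x Tt Ux).
destruct (MVT_gen (fun s => extend u s x) 0 t (fun _ => 0)) as [c [_ Hc]].
- intros s Hst. rewrite Rmin_left in Hst by exact Tt.
  rewrite <- (Hw s x) by (apply Hx || apply Hst).
  apply extend_is_derive_t; [intros; apply Reg; assumption|apply Hst].
- intros s _. apply continuity_pt_filterlim.
  apply continuity_2d_continuous_fst, extend_continuity, Reg.
- rewrite (extend_id u 0 x T0 Ux), (proj1 (Hini x Ux)) in Hc. lra.
Qed.

Lemma solution_unique (sigma mu : R) (f g d : R -> R) (u v : R -> R -> R) :
  0 < sigma -> 0 <= mu -> is_solution sigma mu f g d u -> is_solution sigma mu f g d v ->
  forall t x, 0 <= t -> 0 <= x <= 1 -> v t x = u t x.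
Proof.
intros Hs Hm [Cu [Ku [Pu [Bu Iu]]]] [Cv [Kv [Pv [Bv Iv]]]] t x Ht Hx.
apply Rminus_diag_uniq.
eapply (zero_data_solution (fun t x => v t x - u t x)); [exact Hs|exact Hm| | | | |exact Ht|exact Hx].
- apply regular_minus; apply Ck_strip_2_regular; assumption.
- intros s y H1 H2. simpl. rewrite (Pu s y), (Pv s y) by assumption. ring.
- intros s H1. simpl. destruct (Bu s H1) as [-> ->], (Bv s H1) as [-> ->]. split; ring.
- intros y H1. simpl. destruct (Iu y H1) as [-> ->], (Iv y H1) as [-> ->]. split; ring.
Qed.

(** * Time-harmonic waves *)

(* [csinh k y] and [ccosh k y] are sinh (k y) and cosh (k y) for complex k. *)
Definition csinh (k : C) (y : R) : C :=
  (sinh (fst k * y) * cos (snd k * y), cosh (fst k * y) * sin (snd k * y)).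

Definition ccosh (k : C) (y : R) : C :=
  (cosh (fst k * y) * cos (snd k * y), sinh (fst k * y) * sin (snd k * y)).

(** The solutions of y'' = k^2 y in terms of 1 - x. The wave of interest has no cosh part; that part
    is carried along to close the family under d/dx. *)
Definition profile (k : C) (z : C * C) (x : R) : C :=
  (fst z * csinh k (1 - x) + snd z * ccosh k (1 - x))%C.

(* The real part of [exp (i omega t) * profile k z x]. *)
Definition wave (k : C) (omega : R) (z : C * C) (t x : R) : R :=
  cos (omega * t) * fst (profile k z x) - sin (omega * t) * snd (profile k z x).

(* Differentiation in t and in x acts on the pair of amplitudes. *)
Definition amp_t (omega : R) (z : C * C) : C * C :=
  ((0, omega) * fst z, (0, omega) * snd z)%C.

Definition amp_x (k : C) (z : C * C) : C * C := (- k * snd z, - k * fst z)%C.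

Lemma wave_derive_t (k : C) (omega : R) (z : C * C) (t x : R) :
  is_derive (fun s => wave k omega z s x) t (wave k omega (amp_t omega z) t x).
Proof.
unfold wave. auto_derive; [exact I|].
unfold amp_t, profile, Cplus, Cmult; simpl. ring.
Qed.

Lemma wave_derive_x (k : C) (omega : R) (z : C * C) (t x : R) :
  is_derive (wave k omega z t) x (wave k omega (amp_x k z) t x).
Proof.
destruct k as [a b], z as [[p q] [r s]].
unfold wave, amp_x, profile, csinh, ccosh, Cplus, Cmult, Copp, sinh, cosh; simpl.
auto_derive; [exact I|].
unfold Rminus. field.
Qed.

Lemma wave_continuous (k : C) (omega : R) (z : C * C) (p : R * R) :
  continuous (fun q : R * R => wave k omega z (fst q) (snd q)) p.
Proof.
destruct p as [t x]. apply continuity_2d_pt_filterlim.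
assert (Ht : forall f : R -> R, ex_derive f t -> continuity_2d_pt (fun s _ => f s) t x).
{ intros f Hf. apply (continuity_1d_2d_pt_comp f (fun s _ => s)).
  - apply continuity_pt_filterlim, (ex_derive_continuous f), Hf.
  - apply continuity_2d_pt_id1. }
assert (Hx : forall f : R -> R, ex_derive f x -> continuity_2d_pt (fun _ y => f y) t x).
{ intros f Hf. apply (continuity_1d_2d_pt_comp f (fun _ y => y)).
  - apply continuity_pt_filterlim, (ex_derive_continuous f), Hf.
  - apply continuity_2d_pt_id2. }
unfold wave. apply continuity_2d_pt_minus; apply continuity_2d_pt_mult.
- apply (Ht (fun s => cos (omega * s))). auto_derive. exact I.
- apply (Hx (fun y => fst (profile k z y))).
  unfold profile, csinh, ccosh, Cplus, Cmult, sinh, cosh; simpl. auto_derive. exact I.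
- apply (Ht (fun s => sin (omega * s))). auto_derive. exact I.
- apply (Hx (fun y => snd (profile k z y))).
  unfold profile, csinh, ccosh, Cplus, Cmult, sinh, cosh; simpl. auto_derive. exact I.
Qed.

(** Both partial derivatives are waves with new amplitudes, hence the induction with [z] general. *)
Lemma wave_Ck_strip (n : nat) (k : C) (omega : R) (z : C * C) : Ck_strip n (wave k omega z).
Proof.
revert z. induction n as [|n IH]; intros z.
- split; [|exact I]. apply continuous_on_forall. intros p _. apply wave_continuous.
- apply Ck_strip_S with (wave k omega (amp_t omega z)) (wave k omega (amp_x k z)); auto.
  + apply continuous_on_forall. intros p _. apply wave_continuous.
  + intros t x _ _. apply is_derive_on_within, wave_derive_t.
  + intros t x _ _. apply is_derive_on_within, wave_derive_x.
Qed.

Lemma wave_Ck_unit (n : nat) (k : C) (omega : R) (z : C * C) (t : R) :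
  Ck_on n unit_interval (wave k omega z t).
Proof.
assert (Hc : forall z', continuous_on unit_interval (wave k omega z' t)).
{ intros z'. apply continuous_on_forall. intros x _.
  apply (ex_derive_continuous (wave k omega z' t)). eexists. apply wave_derive_x. }
revert z. induction n as [|n IH]; intros z; [split; [apply Hc|exact I]|].
apply Ck_on_S with (wave k omega (amp_x k z) t); auto using accumulating_unit_interval.
intros x _. apply is_derive_on_within, wave_derive_x.
Qed.

Lemma wave_Ck_half_line (n : nat) (k : C) (omega : R) (z : C * C) (x : R) :
  Ck_on n half_line (fun t => wave k omega z t x).
Proof.
assert (Hc : forall z', continuous_on half_line (fun t => wave k omega z' t x)).
{ intros z'. apply continuous_on_forall. intros t _.
  apply (ex_derive_continuous (fun s => wave k omega z' s x)). eexists. apply wave_derive_t. }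
revert z. induction n as [|n IH]; intros z; [split; [apply Hc|exact I]|].
apply Ck_on_S with (fun t => wave k omega (amp_t omega z) t x); auto using accumulating_half_line.
intros t _. apply is_derive_on_within, wave_derive_t.
Qed.

(** Stated for any [u] that agrees with a wave on the domain, so that it can be iterated: [Dt] of a
    wave is known to be a wave on the domain only. *)
Lemma Dt_wave (u : R -> R -> R) (k : C) (omega : R) (z : C * C) (t x : R) :
  (forall s, half_line s -> u s x = wave k omega z s x) -> half_line t ->
  Dt u t x = wave k omega (amp_t omega z) t x.
Proof.
intros Hu Ht. apply Derive_on_eq; auto using accumulating_half_line.
apply is_derive_on_ext with (fun s => wave k omega z s x); auto.
- intros s Hs. symmetry. auto.
- apply is_derive_on_within, wave_derive_t.
Qed.

Lemma Dx_wave (u : R -> R -> R) (k : C) (omega : R) (z : C * C) (t x : R) :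
  (forall y, unit_interval y -> u t y = wave k omega z t y) -> unit_interval x ->
  Dx u t x = wave k omega (amp_x k z) t x.
Proof.
intros Hu Hx. apply Derive_on_eq; auto using accumulating_unit_interval.
apply is_derive_on_ext with (wave k omega z t); auto.
- intros s Hs. symmetry. auto.
- apply is_derive_on_within, wave_derive_x.
Qed.

Lemma wave_dispersion (sigma mu omega : R) (k : C) (z : C * C) (t x : R) :
  (k * k * (1, sigma * omega)%R)%C = (- omega ^ 2, mu * omega) ->
  wave k omega (amp_t omega (amp_t omega z)) t x
  = wave k omega (amp_x k (amp_x k z)) t x
    + sigma * wave k omega (amp_x k (amp_x k (amp_t omega z))) t x
    - mu * wave k omega (amp_t omega z) t x.
Proof.
destruct k as [a b], z as [[p q] [r s]]. unfold Cmult; simpl. intros H.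
injection H as H1 H2.
apply Rminus_diag_uniq.
(* The residual is Re((alpha + i beta) W) = alpha Re W + beta Re(i W), where alpha + i beta =
   -omega^2 + i mu omega - k^2 (1 + i sigma omega). The second wave has the amplitudes multiplied by
   i. *)
transitivity (
  ((- (omega * (omega * 1))) - ((a * a - b * b) * 1 - (a * b + b * a) * (sigma * omega)))
    * wave (a, b) omega ((p, q), (r, s)) t x
  + (mu * omega - ((a * a - b * b) * (sigma * omega) + (a * b + b * a) * 1))
    * wave (a, b) omega ((- q, p), (- s, r)) t x).
- unfold wave, amp_t, amp_x, profile, Cplus, Cmult, Copp; simpl. ring.
- rewrite H1, H2. ring.
Qed.

Lemma wave_is_solution (sigma mu omega : R) (k c : C) :
  (k * k * (1, sigma * omega)%R)%C = (- omega ^ 2, mu * omega) ->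
  is_solution sigma mu (wave k omega (c, RtoC 0) 0) (wave k omega (amp_t omega (c, RtoC 0)) 0)
    (fun t => wave k omega (c, RtoC 0) t 0) (wave k omega (c, RtoC 0)).
Proof.
intros Hk. set (z := (c, RtoC 0)).
assert (H1 : forall s y, half_line s -> Dt (wave k omega z) s y = wave k omega (amp_t omega z) s y)
  by (intros; apply Dt_wave; auto).
split; [apply wave_Ck_strip|]. split; [|split; [|split]].
- intros t Ht. apply Ck_on_ext with (wave k omega (amp_t omega z) t).
  + exact accumulating_unit_interval.
  + intros x _. symmetry. apply H1, Ht.
  + apply wave_Ck_unit.
- intros t x Ht Hx.
  assert (Tt : half_line t) by (unfold half_line; lra).
  assert (Ux : unit_interval x) by (unfold unit_interval; lra).
  rewrite (Dt_wave (Dt (wave k omega z)) k omega (amp_t omega z)) by auto.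
  rewrite (Dx_wave (Dx (wave k omega z)) k omega (amp_x k z))
    by (auto; intros; apply Dx_wave; auto).
  rewrite (Dx_wave (Dx (Dt (wave k omega z))) k omega (amp_x k (amp_t omega z)))
    by (auto; intros; apply Dx_wave; auto).
  rewrite H1 by assumption. apply wave_dispersion, Hk.
- intros t _. split; [reflexivity|].
  unfold wave, z, profile, csinh, RtoC, Cplus, Cmult; simpl.
  rewrite Rminus_diag, !Rmult_0_r, sinh_0, sin_0. ring.
- intros x Hx. split; [reflexivity|]. apply H1. unfold half_line; lra.
Qed.

(** * The L2 norm of a wave *)

(** The arc cosine of x / rho gives the angle up to sign, and the sign of y decides; at the origin
    any angle serves. *)
Lemma polar (x y : R) :
  exists phi, x = sqrt (x ^ 2 + y ^ 2) * cos phi /\ y = sqrt (x ^ 2 + y ^ 2) * sin phi.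
Proof.
set (rho := sqrt (x ^ 2 + y ^ 2)).
assert (Hx2 := pow2_ge_0 x). assert (Hy2 := pow2_ge_0 y).
assert (Hr2 : rho * rho = x ^ 2 + y ^ 2) by (apply sqrt_sqrt; lra).
assert (Hr : 0 <= rho) by apply sqrt_pos.
destruct (Req_dec rho 0) as [H0|H0].
{ exists 0. rewrite H0 in *. nra. }
assert (Hu : (x / rho) ^ 2 + (y / rho) ^ 2 = 1).
{ replace ((x / rho) ^ 2 + (y / rho) ^ 2) with ((x ^ 2 + y ^ 2) / (rho * rho)) by (field; assumption).
  rewrite Hr2. field. nra. }
assert (Hb : -1 <= x / rho <= 1) by nra.
assert (Hs : sin (acos (x / rho)) = Rabs (y / rho)).
{ rewrite sin_acos by exact Hb. rewrite <- sqrt_Rsqr_abs. f_equal. unfold Rsqr. lra. }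
assert (Hc := cos_acos _ Hb).
destruct (Rle_dec 0 (y / rho)) as [Hy|Hy].
- exists (acos (x / rho)). rewrite Hc, Hs, Rabs_pos_eq by exact Hy. split; field; assumption.
- exists (- acos (x / rho)). rewrite cos_neg, sin_neg, Hc, Hs, Rabs_left by lra. split; field; assumption.
Qed.

Lemma cosh_sinh_1 (x : R) : cosh x * cosh x - sinh x * sinh x = 1.
Proof.
unfold cosh, sinh. assert (H : exp x * exp (- x) = 1) by (rewrite <- exp_plus, Rplus_opp_r; apply exp_0).
transitivity (exp x * exp (- x)); [field|exact H].
Qed.

Lemma cosh_double (x : R) : cosh (2 * x) = cosh x * cosh x + sinh x * sinh x.
Proof.
unfold cosh, sinh. replace (- (2 * x)) with (- x + - x) by ring.
replace (2 * x) with (x + x) by ring. rewrite !exp_plus. field.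
Qed.

Lemma sinh_double (x : R) : sinh (2 * x) = 2 * sinh x * cosh x.
Proof.
unfold cosh, sinh. replace (- (2 * x)) with (- x + - x) by ring.
replace (2 * x) with (x + x) by ring. rewrite !exp_plus. field.
Qed.

Lemma sin_cos_1 (x : R) : cos x * cos x + sin x * sin x = 1.
Proof. assert (H := sin2_cos2 x). unfold Rsqr in H. lra. Qed.

Lemma sinh_pos (x : R) : 0 < x -> 0 < sinh x.
Proof. intros Hx. unfold sinh. assert (H := exp_increasing (- x) x). lra. Qed.

(* |sinh k|^2 *)
Definition sinh_normsq (k : C) : R := fst (csinh k 1) ^ 2 + snd (csinh k 1) ^ 2.

Lemma sinh_normsq_double (a b : R) : 2 * sinh_normsq (a, b) = cosh (2 * a) - cos (2 * b).
Proof.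
unfold sinh_normsq, csinh; simpl. rewrite !Rmult_1_r.
rewrite cosh_double, cos_2a.
assert (H1 := cosh_sinh_1 a). assert (H2 := sin_cos_1 b).
transitivity ((cosh a * cosh a + sinh a * sinh a) * (cos b * cos b + sin b * sin b)
  - (cos b * cos b - sin b * sin b) * (cosh a * cosh a - sinh a * sinh a)); [ring|].
rewrite H1, H2. ring.
Qed.

(** The zeros of sinh lie on the imaginary axis: for [a > 0], cosh(2a) > 1 >= cos(2b). *)
Lemma sinh_normsq_pos (a b : R) : 0 < a -> 0 < sinh_normsq (a, b).
Proof.
intros Ha. assert (H := sinh_normsq_double a b).
assert (H1 := sinh_pos a Ha). assert (H2 := COS_bound (2 * b)).
rewrite cosh_double in H. assert (H3 := cosh_sinh_1 a). nra.
Qed.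

(* Real and imaginary parts of [sinh (2 k y) / (2 k)]. *)
Definition primitive_re (a b y : R) : R :=
  (a * sinh (2 * a * y) * cos (2 * b * y) + b * cosh (2 * a * y) * sin (2 * b * y)) / (2 * (a ^ 2 + b ^ 2)).

Definition primitive_im (a b y : R) : R :=
  (a * cosh (2 * a * y) * sin (2 * b * y) - b * sinh (2 * a * y) * cos (2 * b * y)) / (2 * (a ^ 2 + b ^ 2)).

(* Primitive in y of (Re (exp (i phi) sinh (k y)))^2. *)
Definition energy_primitive (a b phi y : R) : R :=
  (sinh (2 * a * y) / (2 * a) - sin (2 * b * y) / (2 * b)
   + cos (2 * phi) * (primitive_re a b y - y) - sin (2 * phi) * primitive_im a b y) / 4.

(** This is (Re v)^2 = (|v|^2 + Re v^2) / 2 for v = exp(i phi) sinh(ky), together with 2 sinh^2(ky)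
    = cosh(2ky) - 1. *)
Lemma square_profile (a b phi y : R) :
  (cos phi * (sinh (a * y) * cos (b * y)) - sin phi * (cosh (a * y) * sin (b * y))) ^ 2
  = (cosh (2 * a * y) - cos (2 * b * y) + cos (2 * phi) * (cosh (2 * a * y) * cos (2 * b * y) - 1)
     - sin (2 * phi) * (sinh (2 * a * y) * sin (2 * b * y))) / 4.
Proof.
rewrite !(Rmult_assoc 2). rewrite cosh_double, sinh_double, !cos_2a, !sin_2a.
assert (H1 := cosh_sinh_1 (a * y)). assert (H2 := sin_cos_1 (b * y)). assert (H3 := sin_cos_1 phi).
set (ch := cosh (a * y)) in *. set (sh := sinh (a * y)) in *.
set (c := cos (b * y)) in *. set (s := sin (b * y)) in *.
set (cp := cos phi) in *. set (sp := sin phi) in *.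
(* The right-hand side made homogeneous with the three Pythagorean identities. *)
transitivity (((ch * ch + sh * sh) * (c * c + s * s) * (cp * cp + sp * sp)
  - (c * c - s * s) * (ch * ch - sh * sh) * (cp * cp + sp * sp)
  + (cp * cp - sp * sp) * ((ch * ch + sh * sh) * (c * c - s * s) - (ch * ch - sh * sh) * (c * c + s * s))
  - (2 * sp * cp) * (2 * sh * ch * (2 * s * c))) / 4); [field|].
rewrite H1, H2, H3. field.
Qed.

Lemma energy_primitive_derive (a b phi y : R) : 0 < a -> 0 < b ->
  is_derive (energy_primitive a b phi) y
    ((cos phi * (sinh (a * y) * cos (b * y)) - sin phi * (cosh (a * y) * sin (b * y))) ^ 2).
Proof.
intros Ha Hb. rewrite square_profile.
unfold energy_primitive, primitive_re, primitive_im, sinh, cosh.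
auto_derive; [exact I|].
field. split; [nra|]; lra.
Qed.

Lemma wave_L2norm (a b omega m t : R) : 0 < a -> 0 < b ->
  L2norm (wave (a, b) omega (RtoC m, RtoC 0) t)
  = sqrt (m ^ 2 * energy_primitive a b (omega * t) 1).
Proof.
intros Ha Hb. unfold L2norm. f_equal.
apply is_RInt_unique.
(* The substitution y = 1 - x reverses orientation, hence the sign; the primitive vanishes at y =
   0. *)
pose (F := fun x => - m ^ 2 * energy_primitive a b (omega * t) (1 - x)).
pose (f := fun x => m ^ 2 * (cos (omega * t) * (sinh (a * (1 - x)) * cos (b * (1 - x)))
   - sin (omega * t) * (cosh (a * (1 - x)) * sin (b * (1 - x)))) ^ 2).
replace (m ^ 2 * energy_primitive a b (omega * t) 1) with (minus (F 1) (F 0)).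
2:{ unfold minus, plus, opp, F; simpl. rewrite Rminus_diag, Rminus_0_r.
  replace (energy_primitive a b (omega * t) 0) with 0; [ring|].
  unfold energy_primitive, primitive_re, primitive_im.
  rewrite !Rmult_0_r, sinh_0, sin_0. field. split; [nra|]; lra. }
apply is_RInt_ext with f.
{ intros x _. rewrite pow2_abs. unfold f, wave, profile, csinh, RtoC, Cplus, Cmult; simpl. ring. }
apply (is_RInt_derive F f).
- intros x _. unfold F, f.
  replace (m ^ 2 * (cos (omega * t) * (sinh (a * (1 - x)) * cos (b * (1 - x))) -
    sin (omega * t) * (cosh (a * (1 - x)) * sin (b * (1 - x)))) ^ 2)
  with (- m ^ 2 * ((-1) * (cos (omega * t) * (sinh (a * (1 - x)) * cos (b * (1 - x))) -
    sin (omega * t) * (cosh (a * (1 - x)) * sin (b * (1 - x)))) ^ 2)) by ring.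
  apply is_derive_scal.
  apply (is_derive_comp (energy_primitive a b (omega * t)) (fun x => 1 - x)).
  + apply energy_primitive_derive; assumption.
  + auto_derive; [exact I|ring].
- intros x _. apply (ex_derive_continuous f). unfold f, sinh, cosh. auto_derive. exact I.
Qed.

(** Here [rho] = |sinh(2k)/(2k) - 1| is the amplitude of the part of the energy that oscillates in
    time, and the numerator of M is |sinh(2k) - 2k|^2 = 4 |k|^2 rho^2. *)
Lemma p_plus_sqrt_M (a b rho : R) : 0 < a -> 0 < b ->
  rho = sqrt ((primitive_re a b 1 - 1) ^ 2 + (- primitive_im a b 1) ^ 2) ->
  (sinh (2 * a) / (2 * a) - sin (2 * b) / (2 * b) + rho) / 4 / sinh_normsq (a, b)
  = (b * sinh (2 * a) - a * sin (2 * b)) / (4 * a * b * (cosh (2 * a) - cos (2 * b)))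
    + sqrt ((4 * (a ^ 2 + b ^ 2)
        - 4 * (b * sin (2 * b) * cosh (2 * a) + a * sinh (2 * a) * cos (2 * b))
        + sinh (2 * a) ^ 2 + sin (2 * b) ^ 2)
      / (16 * (a ^ 2 + b ^ 2) * (cosh (2 * a) - cos (2 * b)) ^ 2)).
Proof.
intros Ha Hb Hrho.
assert (HN := sinh_normsq_pos a b Ha).
replace (sinh_normsq (a, b)) with ((cosh (2 * a) - cos (2 * b)) / 2)
  by (rewrite <- sinh_normsq_double; field).
rewrite <- sinh_normsq_double.
assert (HD := sinh_normsq_double a b).
assert (Hr0 : 0 <= rho) by (rewrite Hrho; apply sqrt_pos).
assert (Hr2 : rho ^ 2 = (primitive_re a b 1 - 1) ^ 2 + (- primitive_im a b 1) ^ 2).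
{ rewrite Hrho. apply pow2_sqrt.
  apply Rplus_le_le_0_compat; apply pow2_ge_0. }
assert (Hq : 0 < a ^ 2 + b ^ 2) by nra.
assert (Hnum : 4 * (a ^ 2 + b ^ 2)
        - 4 * (b * sin (2 * b) * cosh (2 * a) + a * sinh (2 * a) * cos (2 * b))
        + sinh (2 * a) ^ 2 + sin (2 * b) ^ 2 = 4 * (a ^ 2 + b ^ 2) * rho ^ 2).
{ rewrite Hr2. unfold primitive_re, primitive_im. rewrite !Rmult_1_r.
  assert (H1 := cosh_sinh_1 (2 * a)). assert (H2 := sin_cos_1 (2 * b)).
  set (ch := cosh (2 * a)) in *. set (sh := sinh (2 * a)) in *.
  set (c := cos (2 * b)) in *. set (s := sin (2 * b)) in *.
  (* Two expressions of |sinh(2k)|^2: [sh ^ 2 + s ^ 2] and the sum of squares of its real and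
     imaginary parts. *)
  transitivity (4 * (a ^ 2 + b ^ 2) - 4 * (b * s * ch + a * sh * c) + (sh ^ 2 * c ^ 2 + ch ^ 2 * s ^ 2)).
  - replace (sh ^ 2) with (sh ^ 2 * (c * c + s * s)) at 1 by (rewrite H2; ring).
    replace (s ^ 2) with (s ^ 2 * (ch * ch - sh * sh)) at 1 by (rewrite H1; ring). ring.
  - field. lra. }
rewrite Hnum.
replace (4 * (a ^ 2 + b ^ 2) * rho ^ 2 / (16 * (a ^ 2 + b ^ 2) * (2 * sinh_normsq (a, b)) ^ 2))
  with ((rho / (4 * sinh_normsq (a, b))) ^ 2) by (field; lra).
rewrite sqrt_pow2 by (apply Rdiv_le_0_compat; lra).
field. lra.
Qed.

(** * The asymptotic gain *)

(** Multiplying (-omega^2 + i mu omega) / (1 + i sigma omega) through by the conjugate denominator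
    gives r exp(i theta). Its square root of argument theta/2 lies in the open first quadrant. *)
Lemma wavenumber (sigma mu omega : R) : 0 < sigma -> 0 <= mu -> 0 < omega ->
  let a := a_of sigma mu omega in let b := b_of sigma mu omega in
  0 < a /\ 0 < b /\
  ((a, b) * (a, b) * (1, sigma * omega)%R)%C = (- omega ^ 2, mu * omega).
Proof.
intros Hs Hm Ho a b.
destruct (theta_of_correct sigma mu omega Hs Hm Ho) as [Hth [Hc Hsn]].
assert (Hd : 0 < 1 + sigma ^ 2 * omega ^ 2).
{ assert (H := Rmult_le_pos _ _ (pow2_ge_0 sigma) (pow2_ge_0 omega)). lra. }
assert (Hr : 0 < r_of sigma mu omega).
{ unfold r_of. apply Rdiv_lt_0_compat; [|exact Hd]. apply Rmult_lt_0_compat; [exact Ho|].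
  apply sqrt_lt_R0.
  assert (0 < sigma * omega ^ 2) by (apply Rmult_lt_0_compat; [exact Hs|apply pow_lt, Ho]).
  apply Rplus_le_lt_0_compat; [|apply pow_lt; lra].
  apply Rmult_le_pos; apply pow2_ge_0. }
assert (Hsr : sqrt (r_of sigma mu omega) * sqrt (r_of sigma mu omega) = r_of sigma mu omega)
  by (apply sqrt_sqrt; lra).
assert (Hsr0 : 0 < sqrt (r_of sigma mu omega)) by (apply sqrt_lt_R0, Hr).
unfold a, b, a_of, b_of.
set (th := theta_of sigma mu omega) in *. set (r := r_of sigma mu omega) in *.
set (q := sqrt r) in *.
split; [|split].
- apply Rmult_lt_0_compat; [exact Hsr0|apply cos_gt_0; lra].
- apply Rmult_lt_0_compat; [exact Hsr0|apply sin_gt_0; lra].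
- replace th with (2 * (th / 2)) in Hc, Hsn by field.
  rewrite cos_2a in Hc. rewrite sin_2a in Hsn.
  assert (E1 : (q * cos (th / 2)) * (q * cos (th / 2)) - (q * sin (th / 2)) * (q * sin (th / 2))
    = (mu * sigma - 1) * omega ^ 2 / (1 + sigma ^ 2 * omega ^ 2)).
  { transitivity (q * q * (cos (th / 2) * cos (th / 2) - sin (th / 2) * sin (th / 2))); [ring|].
    rewrite Hc, Hsr. field. lra. }
  assert (E2 : (q * cos (th / 2)) * (q * sin (th / 2)) + (q * sin (th / 2)) * (q * cos (th / 2))
    = (mu + sigma * omega ^ 2) * omega / (1 + sigma ^ 2 * omega ^ 2)).
  { transitivity (q * q * (2 * sin (th / 2) * cos (th / 2))); [ring|].
    rewrite Hsn, Hsr. field. lra. }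
  unfold Cmult; simpl fst; simpl snd. rewrite E1, E2. f_equal; field; lra.
Qed.

(** The phase [kappa] is the argument of sinh k, whose modulus the amplitude cancels. *)
Lemma wave_boundary (a b omega : R) : 0 < a ->
  exists kappa, forall t,
    wave (a, b) omega (RtoC (/ sqrt (sinh_normsq (a, b))), RtoC 0) t 0 = cos (omega * t + kappa).
Proof.
intros Ha.
destruct (polar (fst (csinh (a, b) 1)) (snd (csinh (a, b) 1))) as [kappa [H1 H2]].
fold (sinh_normsq (a, b)) in H1, H2.
assert (HN := sqrt_lt_R0 _ (sinh_normsq_pos a b Ha)).
exists kappa. intros t. unfold wave, profile. rewrite Rminus_0_r.
unfold RtoC, Cplus, Cmult; simpl fst; simpl snd.
change (sinh (a * 1) * cos (b * 1)) with (fst (csinh (a, b) 1)).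
change (cosh (a * 1) * sin (b * 1)) with (snd (csinh (a, b) 1)).
rewrite H1, H2, cos_plus. field. lra.
Qed.

Lemma cos_phase_recurs (omega kappa phi T : R) : 0 < omega ->
  exists t, T <= t /\ exists n, omega * t + kappa = phi + 2 * INR n * PI.
Proof.
intros Ho. assert (Hpi := PI_RGT_0).
destruct (INR_archimed (2 * PI) (omega * T + kappa - phi)) as [n Hn]; [lra|].
exists ((phi + 2 * INR n * PI - kappa) / omega). split.
- apply Rmult_le_reg_l with omega; [exact Ho|].
  replace (omega * ((phi + 2 * INR n * PI - kappa) / omega)) with (phi + 2 * INR n * PI - kappa) by (field; lra).
  lra.
- exists n. field. lra.
Qed.

Lemma sup_cos (omega kappa : R) (d : R -> R) : 0 < omega ->
  (forall t, d t = cos (omega * t + kappa)) -> sup_half_line d = 1.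
Proof.
intros Ho Hd. apply is_lub_Rbar_unique. split.
- intros y [t [_ ->]]. rewrite Hd. simpl. apply Rabs_le, COS_bound.
- intros M HM. apply HM.
  destruct (cos_phase_recurs omega kappa 0 0 Ho) as [t [Ht [n Hn]]].
  exists t. split; [exact Ht|].
  rewrite Hd, Hn, cos_period, cos_0, Rabs_R1. reflexivity.
Qed.

(** Every tail contains a time with value [q], so [q] bounds all tail suprema from below. *)
Lemma LimSup_infty_recurrent (h : R -> R) (q : R) :
  (forall T, exists t, T <= t /\ h t = q) -> Rbar_le q (LimSup_infty h).
Proof.
intros Hq. unfold LimSup_infty, Rbar_glb.
match goal with |- context [Rbar_ex_glb ?E] => destruct (Rbar_ex_glb E) as [l [Hlb Hl]] end.
cbn [proj1_sig]. apply Hl. intros s [T [_ ->]].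
destruct (Hq T) as [t [Ht Hh]].
apply Lub_Rbar_correct. exists t. auto.
Qed.

Lemma Rbar_div_1 (x : Rbar) : Rbar_div x 1 = x.
Proof.
destruct x as [x| |]; simpl.
- f_equal. field.
- unfold Rbar_mult; simpl. rewrite Rinv_1. destruct (Rle_dec 0 1) as [H|H]; [|lra].
  destruct (Rle_lt_or_eq_dec 0 1 H); [reflexivity|lra].
- unfold Rbar_mult; simpl. rewrite Rinv_1. destruct (Rle_dec 0 1) as [H|H]; [|lra].
  destruct (Rle_lt_or_eq_dec 0 1 H); [reflexivity|lra].
Qed.

Lemma wave_L2norm_recurs (sigma mu omega T : R) : 0 < sigma -> 0 <= mu -> 0 < omega ->
  let a := a_of sigma mu omega in let b := b_of sigma mu omega in
  exists t, T <= t /\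
    L2norm (wave (a, b) omega (RtoC (/ sqrt (sinh_normsq (a, b))), RtoC 0) t) = Q sigma mu omega.
Proof.
intros Hs Hm Ho a b.
destruct (wavenumber sigma mu omega Hs Hm Ho) as [Ha [Hb _]]. fold a in Ha. fold b in Hb.
(* The angle is that of the conjugate of sinh(2k)/(2k) - 1: when 2 omega t equals [psi] modulo 2 pi,
   the rotation cancels the argument and the oscillating part reaches [rho]. *)
destruct (polar (primitive_re a b 1 - 1) (- primitive_im a b 1)) as [psi [H1 H2]].
remember (sqrt ((primitive_re a b 1 - 1) ^ 2 + (- primitive_im a b 1) ^ 2)) as rho eqn:Hrho.
destruct (cos_phase_recurs (2 * omega) 0 psi T) as [t [Ht [n Hn]]]; [lra|].
exists t. split; [exact Ht|].
rewrite wave_L2norm by assumption. unfold Q. f_equal.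
unfold p_of, M_of. fold a b. cbv zeta.
rewrite <- (p_plus_sqrt_M a b rho Ha Hb Hrho).
assert (HN := sinh_normsq_pos a b Ha).
replace ((/ sqrt (sinh_normsq (a, b))) ^ 2) with (/ sinh_normsq (a, b)).
2:{ rewrite pow_inv, pow2_sqrt by lra. reflexivity. }
replace (energy_primitive a b (omega * t) 1)
  with ((sinh (2 * a) / (2 * a) - sin (2 * b) / (2 * b) + rho) / 4); [field; lra|].
unfold energy_primitive. rewrite !Rmult_1_r.
replace (2 * (omega * t)) with (psi + 2 * INR n * PI) by lra.
rewrite cos_period, sin_period.
replace (primitive_im a b 1) with (- (rho * sin psi)) by (rewrite <- H2; ring).
rewrite H1.
assert (H3 := sin_cos_1 psi).
replace rho with (rho * (cos psi * cos psi + sin psi * sin psi)) at 1 by (rewrite H3; ring).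
field. lra.
Qed.

Theorem theorem3p2 :
  forall sigma mu : R, 0 < sigma -> 0 <= mu ->
    Rbar_le (Lub_Rbar (fun q => exists omega, 0 < omega /\ q = Q sigma mu omega))
            (gamma2 sigma mu).
Proof.
intros sigma mu Hs Hm.
apply Lub_Rbar_correct. intros q [omega [Ho ->]].
destruct (wavenumber sigma mu omega Hs Hm Ho) as [Ha [Hb Hk]].
set (a := a_of sigma mu omega) in *. set (b := b_of sigma mu omega) in *.
set (c := RtoC (/ sqrt (sinh_normsq (a, b)))).
set (u := wave (a, b) omega (c, RtoC 0)).
set (d := fun t => u t 0).
assert (Hu := wave_is_solution sigma mu omega (a, b) c Hk). fold u d in Hu.
destruct (wave_boundary a b omega Ha) as [kappa Hd]. fold c u in Hd.
assert (HdC : bounded_C2 d).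
{ split; [apply wave_Ck_half_line|]. exists 1. intros t _.
  unfold d. rewrite Hd. apply Rabs_le, COS_bound. }
assert (Huniq : has_unique_solution sigma mu (u 0) (wave (a, b) omega (amp_t omega (c, RtoC 0)) 0) d).
{ exists u. split; [exact Hu|]. intros v Hv. apply (solution_unique sigma mu _ _ _ _ _ Hs Hm Hu Hv). }
(* The intermediate term is the gain quotient of this one wave, whose denominator is 1. *)
apply Rbar_le_trans with (Rbar_div (LimSup_infty (fun t => L2norm (u t))) (sup_half_line d)).
- rewrite (sup_cos omega kappa d Ho Hd), Rbar_div_1.
  apply LimSup_infty_recurrent. intros T. apply wave_L2norm_recurs; assumption.
- unfold gamma2, Rbar_lub.
  match goal with |- context [Rbar_ex_lub ?E] => destruct (Rbar_ex_lub E) as [l [Hl Hmin]] end.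
  cbn [proj1_sig]. apply Hl.
  exists (u 0), (wave (a, b) omega (amp_t omega (c, RtoC 0)) 0), d, u.
  split; [|split; [|split; [|split]]].
  + split; [apply wave_Ck_unit|]. split; [apply wave_Ck_unit|]. exists d. split; assumption.
  + split; assumption.
  (* At a nonnegative time of phase 0 modulo 2 pi the input equals 1. *)
  + destruct (cos_phase_recurs omega kappa 0 0 Ho) as [t [Ht [n Hn]]].
    exists t. split; [exact Ht|]. unfold d. rewrite Hd, Hn, cos_period, cos_0. lra.
  + exact Hu.
  + reflexivity.
Qed.
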